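(* Consider a system subject to the extreme shock model, with lifetime $S$, in which the shock process is $M(t)=N^f(G_\mu(t))$, $t\ge0$, i.e. the subordinated Poisson process with Bernstein function $f$ and Poisson intensity $\lambda>0$ time-changed by an independent geometric counting process with parameter $\mu>0$. Let $q$ be the probability that the system survives a shock. Then for $t\ge 0$ the reliability function of the system lifetime is $$\mathbb{P}(S>t)=\frac{1}{1+\mu t\left(1-e^{-f(\lambda(1-q))}\right)},$$ and the corresponding failure rate is $$r_S(t)=\frac{\mu\left(1-e^{-f(\lambda(1-q))}\right)}{1+\mu t\left(1-e^{-f(\lambda(1-q))}\right)}.$$
   Context: $\{D^f(t)\}_{t\ge0}$ is a Lévy subordinator (non-decreasing Lévy process) with $\mathbb{E}[e^{-sD^f(t)}]=e^{-tf(s)}$, where $f(s)=bs+\int_0^\infty(1-e^{-sx})\,\nu(dx)$, $b\ge0$, is a Bernstein function, and $\nu$ is a Lévy measure on the positive half-line with $\int_0^\infty (x\wedge 1)\,\nu(dx)<\infty$ and infinite total mass. $N$ is a homogeneous Poisson process with intensity $\lambda>0$ independent of $D^f$, and $N^f(t)=N(D^f(t))$. The geometric counting process $\{G_\mu(t)\}_{t\ge0}$ is the mixed Poisson process whose random rate is exponentially distributed with mean $\mu>0$, so $\mathbb{P}[G_\mu(t)=k]=\frac{1}{1+\mu t}\left(\frac{\mu t}{1+\mu t}\right)^k$, $k=0,1,2,\dots$; it is independent of $N^f$. Extreme shock model: $M(t)$ counts the shocks in $(0,t]$; shocks are the only cause of failure; the shock magnitudes are i.i.d. and independent of $\{M(t)\}_{t\ge0}$;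 the system fails at the $i$th shock if the magnitude of that shock exceeds a predetermined threshold $\gamma$. Hence each shock is survived with probability $q$ (the probability that a magnitude does not exceed $\gamma$), and $\mathbb{P}(S>t\mid M(t)=k)=q^k$ for $k=0,1,2,\dots$. The failure rate is $r_S(t)=-\frac{d}{dt}\log\mathbb{P}(S>t)$. *)

(* Defs.v *)
From HB Require Import structures.
From mathcomp Require Export all_boot all_order all_algebra.
From mathcomp Require Export all_classical all_reals all_analysis.
From mathcomp Require Export measurable_realfun.

Set Implicit Arguments.
Unset Strict Implicit.
Unset Printing Implicit Defensive.

Import Order.TTheory GRing.Theory Num.Theory.
Import numFieldNormedType.Exports.

Local Open Scope classical_set_scope.
Local Open Scope ring_scope.

(* All processes are indexed by R, but only times in [0, +oo[ are constrained. *)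

Section independence.
Context (R : realType) (d : measure_display) (Omega : measurableType d).
Variable P : probability Omega R.

(* The sigma-algebra generated by the random variables X i, i in J. *)
Definition process_sigma (d' : measure_display) (E : measurableType d')
    (I : Type) (J : set I) (X : I -> Omega -> E) : set (set Omega) :=
  <<s \bigcup_(i in J) preimage_set_system setT (X i) measurable >>.

Definition independent_sigma (F G : set (set Omega)) : Prop :=
  forall A B, F A -> G B -> (P (A `&` B) = P A * P B)%E.

Definition independent_processes
    (d1 d2 : measure_display) (E1 : measurableType d1) (E2 : measurableType d2)
    (I1 I2 : Type) (J1 : set I1) (J2 : set I2)
    (X : I1 -> Omega -> E1) (Y : I2 -> Omega -> E2) : Prop :=
  independent_sigma (process_sigma J1 X) (process_sigma J2 Y).

Definition mutually_independent
    (d' : measure_display) (E : measurableType d') (I : choiceType)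
    (X : I -> Omega -> E) : Prop :=
  forall (s : seq I) (B : I -> set E), uniq s ->
    (forall i, measurable (B i)) ->
    P (\bigcap_(i in [set` s]) (X i @^-1` B i))
    = (\prod_(i <- s) P (X i @^-1` B i))%E.

Definition iid (X : nat -> Omega -> R) : Prop :=
  mutually_independent X /\
  forall i (B : set R), measurable B -> P (X i @^-1` B) = P (X 0%N @^-1` B).

End independence.

Section paths.
Context (R : realType).

Definition nondecreasing_path (x : R -> R) : Prop :=
  forall s t : R, 0 <= s -> s <= t -> x s <= x t.

Definition cadlag_path (x : R -> R) : Prop :=
  (forall t : R, 0 <= t -> x u @[u --> t^'+] --> x t) /\
  (forall t : R, 0 < t -> exists l : R, x u @[u --> t^'-] --> l).

Definition counting_path (x : R -> nat) : Prop :=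
  [/\ x 0 = 0%N, nondecreasing_path (fun t => (x t)%:R)
    & cadlag_path (fun t => (x t)%:R)].

Definition time_grid (t : nat -> R) : Prop :=
  0 <= t 0%N /\ forall i, t i <= t i.+1.

End paths.

Section processes.
Context (R : realType) (d : measure_display) (Omega : measurableType d).
Variable P : probability Omega R.

Definition independent_increments (X : R -> Omega -> R) : Prop :=
  forall t : nat -> R, time_grid t ->
    mutually_independent P (fun (i : nat) w => X (t i.+1) w - X (t i) w).

Definition stationary_increments (X : R -> Omega -> R) : Prop :=
  forall s h : R, 0 <= s -> 0 <= h -> forall B : set R, measurable B ->
    P [set w | B (X (s + h) w - X s w)] = P [set w | B (X h w - X 0 w)].

(* Stochastic continuity follows from the cadlag paths and the stationarity of
   the increments. *)
Definition levy_subordinator (D : R -> {RV P >-> R}) : Prop :=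
  [/\ {ae P, forall w, [/\ D 0 w = 0, nondecreasing_path (fun t => D t w)
                         & cadlag_path (fun t => D t w)]},
      independent_increments (fun t => D t)
    & stationary_increments (fun t => D t)].

(* [poisson_prob r k0] ignores its argument k0; at r = 0 it is the Dirac mass
   at 0, whereas [poisson_pmf] is the constant 1 there. *)
Definition poisson_process (lam : R) (N : R -> {RV P >-> nat}) : Prop :=
  [/\ {ae P, forall w, counting_path (fun t => N t w)},
      independent_increments (fun t w => (N t w)%:R)
    & forall (s t : R) (k : nat), 0 <= s -> s <= t ->
        P [set w | N t w = (N s w + k)%N]
        = poisson_prob (lam * (t - s)) 0%N [set k]].

(* Conditionally on the random rate L, the process G is a Poisson process with
   intensity L: the disintegration with respect to the law of L of the joint
   law of L and of the increments of G. *)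
Definition mixed_poisson_process (L : {RV P >-> R}) (G : R -> {RV P >-> nat}) :
    Prop :=
  {ae P, forall w, counting_path (fun t => G t w)} /\
  forall (n : nat) (t : nat -> R) (k : nat -> nat) (B : set R),
    time_grid t -> measurable B ->
    P (L @^-1` B `&`
       \bigcap_(i < n) [set w | G (t i.+1) w = (G (t i) w + k i)%N])
    = (\int[distribution P L]_(l in B)
         \prod_(i < n) poisson_prob (l * (t i.+1 - t i)) 0%N [set k i])%E.

Definition geometric_counting_process (mu : R) (G : R -> {RV P >-> nat}) :
    Prop :=
  exists L : {RV P >-> R},
    (forall B : set R, measurable B ->
       distribution P L B = exponential_prob mu^-1 B) /\
    mixed_poisson_process L G.

End processes.
Arguments levy_subordinator {R d Omega} P D.
Arguments poisson_process {R d Omega} P lam N.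
Arguments mixed_poisson_process {R d Omega} P L G.
Arguments geometric_counting_process {R d Omega} P mu G.

Section bernstein.
Context (R : realType).

Definition levy_measure_pos (nu : {measure set R -> \bar R}) : Prop :=
  nu `]-oo, 0%R]%classic = 0%E /\
  (\int[nu]_(x in `]0%R, +oo[) (Num.min x 1)%:E < +oo)%E.

Definition bernstein (b : R) (nu : {measure set R -> \bar R}) (s : R) : R :=
  b * s + \int[nu]_(x in `]0, +oo[) (1 - expR (- (s * x))).

End bernstein.

Section reliability.
Context (R : realType).

Definition shock_time (m : R -> nat) (n : nat) : \bar R :=
  ereal_inf [set t%:E | t in [set t : R | 0 <= t /\ (n <= m t)%N]].

(* The magnitude of the n-th shock, n >= 1, is x n.-1. Several shocks may occur
   at the same time. *)
Definition extreme_shock_lifetime (gam : R) (m : R -> nat) (x : nat -> R) :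
    \bar R :=
  ereal_inf [set shock_time m i.+1 | i in [set i | gam < x i]].

Context (d : measure_display) (Omega : measurableType d).
Variable P : probability Omega R.

Definition reliability (S : {RV P >-> \bar R}) (t : R) : R :=
  fine (P [set w | (t%:E < S w)%E]).

(* The derivative is taken along [0, +oo[: two-sided for 0 < t, from the right
   at t = 0. *)
Definition is_failure_rate (S : {RV P >-> \bar R}) (t r : R) : Prop :=
  - (h^-1 * (ln (reliability S (t + h)) - ln (reliability S t)))
    @[h --> within [set h : R | 0 <= t + h] 0^'] --> r.

End reliability.
Arguments reliability {R d Omega} P S t.
Arguments is_failure_rate {R d Omega} P S t r.

(* Main.v *)
From HB Require Import structures.
From mathcomp Require Import ring lra.
Require Import Defs.
Import Order.TTheory GRing.Theory Num.Theory.
Import numFieldNormedType.Exports.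

Set Implicit Arguments.
Unset Strict Implicit.

Local Open Scope classical_set_scope.
Local Open Scope ring_scope.

(* Almost surely the paths of M are nondecreasing, right-continuous and
   integer-valued, so t < S holds exactly when the first M(t) magnitudes do not
   exceed gam, and P(S > t) = E[q^M(t)]. Conditioning on G(t) gives
   E[q^M(t)] = sum_n P(G(t) = n) E[q^Nf(n)].
   The identity E[q^N(D)] = E[exp(-lam (1-q) D)] is clear from the Poisson
   generating function when D takes countably many values; in general D is
   approximated from above by (trunc(m D) + 1)/m, using the right-continuity of
   N and dominated convergence. Hence E[q^Nf(n)] = z^n with
   z = exp(-f(lam (1-q))), and integrating the Poisson generating function
   exp(-l t (1-z)) against the exponential law of the rate l gives
   1/(1 + mu t (1-z)). *)

(** * Integrals split along the fibres of a natural-valued variable *)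

Section mixtures.
Context (R : realType) (d : measure_display) (Omega : measurableType d).
Local Open Scope ereal_scope.

Lemma measurable_fun_natP (f : Omega -> nat) :
  (forall k, measurable (f @^-1` [set k])) -> measurable_fun setT f.
Proof.
move=> mf _ A _; rewrite setTI.
rewrite (_ : f @^-1` A = \bigcup_(k in A) f @^-1` [set k]).
  exact: bigcup_measurable.
by apply/seteqP; split => [w Aw|w [k Ak /= fwk]]; [exists (f w)|rewrite /= fwk].
Qed.

Lemma ge0_integral_nat_partition (mu : {measure set Omega -> \bar R})
    (A : set Omega) (K : Omega -> nat) (F : Omega -> \bar R) :
  measurable A -> measurable_fun setT K -> measurable_fun A F ->
  (forall w, A w -> 0 <= F w) ->
  \int[mu]_(w in A) F w =
  \sum_(k <oo) \int[mu]_(w in A `&` K @^-1` [set k]) F w.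
Proof.
move=> mA mK mF F0.
have AE : A = \bigcup_k (A `&` K @^-1` [set k]).
  by apply/seteqP; split => [w Aw|w [k _ []]//]; exists (K w).
rewrite [in LHS]AE ge0_integral_bigcup -?AE//.
- by move=> k; apply: measurableI => //;
    rewrite -[X in measurable X]setTI; exact: mK.
- apply/trivIsetP => i j _ _ /eqP ij; apply/seteqP; split => // w.
  by move=> [[_ /= Ki] [_ /= Kj]]; case: ij; rewrite -Ki.
Qed.

Lemma ge0_integral_comp_nat (mu : {measure set Omega -> \bar R})
    (A : set Omega) (Y : Omega -> nat) (h : nat -> \bar R) :
  measurable A -> measurable_fun setT Y -> (forall k, 0 <= h k) ->
  \int[mu]_(w in A) h (Y w) =
  \sum_(k <oo) h k * mu (A `&` Y @^-1` [set k]).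
Proof.
move=> mA mY h0.
rewrite (@ge0_integral_nat_partition _ _ Y)//; last first.
  by apply: measurable_funTS; exact: measurableT_comp.
apply: eq_eseriesr => k _.
transitivity (\int[mu]_(w in A `&` Y @^-1` [set k]) cst (h k) w).
  by apply: eq_integral => w /set_mem[_ /= ->].
rewrite integral_cst//; apply: measurableI => //.
by rewrite -[X in measurable X]setTI; exact: mY.
Qed.

Variable P : probability Omega R.

(** On the fibre [K = k] the variable [Z] is [Y k], and independence of [K] from each single [Y k]
    factors that piece. This serves twice: for the discretised subordinator and for the geometric
    time change. *)
Lemma ge0_expectation_mixture (K Z : Omega -> nat) (Y : nat -> Omega -> nat)
    (h : nat -> \bar R) :
  measurable_fun setT K -> measurable_fun setT Z ->
  (forall k, measurable_fun setT (Y k)) ->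
  (forall k, 0 <= h k) -> (forall w, Z w = Y (K w) w) ->
  (forall k j, P (K @^-1` [set k] `&` Y k @^-1` [set j]) =
     P (K @^-1` [set k]) * P (Y k @^-1` [set j])) ->
  \int[P]_w h (Z w) =
  \sum_(k <oo) P (K @^-1` [set k]) * \int[P]_w h (Y k w).
Proof.
move=> mK mZ mY h0 ZY ind.
have mK1 k : measurable (K @^-1` [set k]).
  by rewrite -[X in measurable X]setTI; exact: mK.
rewrite (@ge0_integral_nat_partition _ _ K)//; last exact: measurableT_comp.
apply: eq_eseriesr => k _; rewrite setTI.
transitivity (\int[P]_(w in K @^-1` [set k]) h (Y k w)).
  by apply: eq_integral => w /set_mem /= <-; rewrite ZY.
rewrite ge0_integral_comp_nat// (@ge0_integral_comp_nat P setT)//.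
rewrite -[P (K @^-1` [set k])]fineK ?fin_num_measure//.
rewrite -nneseriesZl; last by move=> *; rewrite mule_ge0.
apply: eq_eseriesr => j _; rewrite setTI [X in h j * X]ind fineK ?fin_num_measure//.
by rewrite muleCA.
Qed.

End mixtures.

(** * Change of density; transforms of the Poisson and exponential laws *)

Section densities.
Context (R : realType).
Local Open Scope ereal_scope.

(** The density makes [nu] absolutely continuous with respect to [m], and its Radon-Nikodym
    derivative equals [p] almost everywhere because both have the same integral over every
    measurable set. *)
Lemma integral_density (d : measure_display) (T : measurableType d)
    (nu : probability T R) (m : {sigma_finite_measure set T -> \bar R})
    (p f : T -> \bar R) :
  m.-integrable setT p ->
  (forall A, measurable A -> nu A = \int[m]_(x in A) p x) ->
  nu.-integrable setT f ->
  \int[nu]_x f x = \int[m]_x (f x * p x).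
Proof.
move=> ip nuE intf.
have dom : nu `<< m.
  apply/null_content_dominatesP => A mA mA0.
  rewrite nuE//; apply: null_set_integral => //.
  exact/measurable_funTS/(measurable_int _ ip).
rewrite -(Radon_Nikodym_change_of_variables dom)//.
apply: ae_eq_integral => //.
- apply: emeasurable_funM; first exact: measurable_int intf.
  by apply: (measurable_int m); exact: Radon_Nikodym_integrable.
- by apply: emeasurable_funM; [exact: measurable_int intf|exact: measurable_int ip].
- apply: ae_eqe_mul2l => /=.
  apply: integral_ae_eq => //=.
  + exact: Radon_Nikodym_integrable.
  + exact: measurable_int ip.
  + by move=> E _ mE; rewrite -nuE// -Radon_Nikodym_integral.
Qed.

Lemma expR_eseries (x : R) : (0 <= x)%R ->
  \sum_(k <oo) (x ^+ k / k`!%:R)%:E = (expR x)%:E.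
Proof.
move=> x0; rewrite expRE -EFin_lim; last first.
  rewrite /pseries/=; under eq_fun do rewrite mulrC.
  exact: is_cvg_series_exp_coeff.
apply/congr_lim/funext => n/=; rewrite /pseries/= /series/= -sumEFin//.
by under eq_bigr do rewrite mulrC.
Qed.

(** At [r = 0] the law is the Dirac mass at 0 and the series is read as an integral against it. For
    [r > 0] the terms are exp(-r) (r q)^k / k!, an exponential series. *)
Lemma poisson_prob_pgf (r q : R) (k0 : nat) : (0 <= r)%R -> (0 <= q)%R ->
  \sum_(k <oo) (q ^+ k)%:E * poisson_prob r k0 [set k] =
  (expR (- (r * (1 - q))))%:E.
Proof.
rewrite le_eqVlt => /predU1P[<-|r0] q0.
  transitivity (\int[\d_0%N]_k (q ^+ k)%:E).
    rewrite (@ge0_integral_comp_nat _ _ _ \d_0%N setT id (fun k => (q ^+ k)%:E))//.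
      by apply: eq_eseriesr => k _; rewrite setTI /poisson_prob ltxx.
    by move=> k; rewrite lee_fin exprn_ge0.
  by rewrite integral_dirac// diracT mul1e expr0 mul0r oppr0 expR0.
under eq_eseriesr => k _.
  rewrite /poisson_prob r0 esum_set1 ?lee_fin ?poisson_pmf_ge0//.
  rewrite /poisson_pmf r0 -EFinM.
  rewrite [X in X%:E](_ : _ = expR (- r) * ((r * q) ^+ k / k`!%:R))%R; last first.
    rewrite exprMn; move: (q ^+ k)%R (r ^+ k)%R (k`!%:R^-1)%R (expR _) => *.
    ring.
  rewrite EFinM; over.
rewrite nneseriesZl; last first.
  by move=> k _; rewrite lee_fin divr_ge0// exprn_ge0// mulr_ge0// ltW.
rewrite expR_eseries; last by rewrite mulr_ge0// ltW.
by rewrite -EFinM -expRD; congr (expR _)%:E; ring.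
Qed.

(** Multiplying the exponential density of rate [a] by exp(-c l) gives a / (a + c) times the density
    of rate [a + c], whose total mass is 1. *)
Lemma exponential_laplace_measurableTypeR
    (nu : probability (measurableTypeR R) R) (a c : R) :
  (0 < a)%R -> (0 <= c)%R ->
  (forall B, measurable B -> nu B = exponential_prob a B) ->
  \int[nu]_(l in `[0%R, +oo[) (expR (- (c * l)))%:E = (a / (a + c))%:E.
Proof.
move=> a0 c0 nuE.
(* Cutting off the negative half-line bounds the integrand by 1, which makes it integrable under
   [nu]. *)
pose f : R -> \bar R := (fun l => (expR (- (c * l)))%:E) \_ `[0%R, +oo[.
have ac0 : (0 < a + c)%R by rewrite ltr_wpDr.
have intf : nu.-integrable setT f.
  apply: (@le_integrable _ _ _ nu _ measurableT _ (cst 1)).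
  - apply/(measurable_restrictT _ _).1 => //; apply: measurable_funTS.
    apply/measurable_EFinP; apply: measurableT_comp => //.
    by apply: measurable_funN; exact: mulrl_measurable.
  - move=> l _; rewrite /f patchE [cst _ _]/= abse1.
    case: ifPn => [|_]; last by rewrite abse0.
    rewrite inE /= in_itv /= andbT => l0.
    by rewrite ger0_norm ?expR_ge0// lee_fin expR_le1 oppr_le0 mulr_ge0.
  - exact: finite_measure_integrable_cst.
rewrite integral_mkcond.
rewrite (integral_density (integrable_exponential_pdf a0) nuE intf).
transitivity (\int[lebesgue_measure]_l
    ((a / (a + c))%:E * (exponential_pdf (a + c) l)%:E)).
  apply: eq_integral => l _; rewrite /f patchE; case: ifPn.
    rewrite inE /= in_itv /= andbT => l0.
    rewrite !exponential_pdfE// -!EFinM; congr EFin.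
    rewrite mulrCA -expRD mulrA divfK ?gt_eqF//; congr (_ * expR _)%R; ring.
  rewrite notin_setE /= in_itv /= andbT => /negP; rewrite -ltNge => l0.
  by rewrite !lt0_exponential_pdf// !mule0.
rewrite integralZl//; last exact: integrable_exponential_pdf.
by rewrite integral_exponential_pdf// mule1.
Qed.

(* The Borel structures of [R] and of [measurableTypeR R], which carries
   [lebesgue_measure], are convertible but not unifiable. *)
Lemma exponential_laplace (nu : probability R R) (a c : R) :
  (0 < a)%R -> (0 <= c)%R ->
  (forall B, measurable B -> nu B = exponential_prob a B) ->
  \int[nu]_(l in `[0%R, +oo[) (expR (- (c * l)))%:E = (a / (a + c))%:E.
Proof.
move=> a0 c0 nuE.
have mid : measurable_fun setT (id : R -> measurableTypeR R).
  by move=> _ B mB; rewrite setTI.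
(* The law is carried to the other Borel structure as its image under the identity. *)
pose X : {mfun R >-> measurableTypeR R} :=
  HB.pack (id : R -> measurableTypeR R) (isMeasurableFun.Build _ _ _ _ _ mid).
rewrite -(exponential_laplace_measurableTypeR (nu := distribution nu X) a0 c0)//.
rewrite ge0_integral_pushforward//.
by apply: measurable_funTS; apply/measurable_EFinP; apply: measurableT_comp => //;
   apply: measurable_funN; exact: mulrl_measurable.
Qed.

End densities.

(** * Generating functions of the Poisson and geometric counting processes *)

Section processes.
Context (R : realType) (d : measure_display) (Omega : measurableType d).
Variable P : probability Omega R.
Local Open Scope ereal_scope.

(** Path properties such as [N 0 = 0] hold only almost surely; this allows them to be used inside
    probabilities. The indicators agree almost everywhere, hence so do their integrals. *)
Lemma ae_iff_measure (A B : set Omega) :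
  measurable A -> measurable B -> {ae P, forall w, A w <-> B w} -> P A = P B.
Proof.
move=> mA mB AB; rewrite -[A]setIT -[B]setIT -!integral_indic//.
apply: ge0_ae_eq_integral => //.
- by apply/measurable_EFinP; exact: measurable_indic.
- by apply/measurable_EFinP; exact: measurable_indic.
- case: AB => N [mN N0 subN]; exists N; split => // w /= neq; apply: subN => /= AB.
  apply: neq => _; rewrite !indicE.
  suff -> : (w \in A) = (w \in B) by [].
  by apply/idP/idP; rewrite !inE => /AB.
Qed.

Lemma measurable_poisson_prob1 (D : set R) (k0 n : nat) :
  measurable D -> measurable_fun D (fun r : R => poisson_prob r k0 [set n]).
Proof.
move=> mD; apply: (eq_measurable_fun (fun r : R =>
    if (0 < r)%R then (poisson_pmf r n)%:E else \d_0%N [set n])).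
  move=> r _; rewrite /poisson_prob; case: ifPn => // _.
  by rewrite esum_set1// lee_fin poisson_pmf_ge0.
apply: measurable_fun_if => //; first exact: measurable_fun_ltr.
apply/measurable_EFinP; apply: measurable_poisson_pmf.
rewrite (_ : _ @^-1` _ = `]0%R, +oo[%classic); first exact: measurableI.
by apply/seteqP; split => /= x /=; rewrite in_itv/= andbT.
Qed.

Lemma measurable_nat_fiber (Y : {RV P >-> nat}) (A : set nat) :
  measurable [set w | A (Y w)].
Proof. by rewrite -[X in measurable X]setTI; exact: measurable_funP. Qed.

Lemma measurable_nat_increment (Y Z : {RV P >-> nat}) (k : nat) :
  measurable [set w | Z w = (Y w + k)%N].
Proof.
rewrite (_ : mkset _ = \bigcup_j ([set w | Y w = j] `&` [set w | Z w = (j + k)%N])).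
  apply: bigcup_measurable => j _.
  by apply: measurableI; [exact: (@measurable_nat_fiber Y [set j])
                         |exact: (@measurable_nat_fiber Z [set (j + k)%N])].
by apply/seteqP; split => [w /= Zw|w [j _ [/= -> ->]]//]; exists (Y w).
Qed.

Lemma poisson_process_pgf (lam : R) (N : R -> {RV P >-> nat}) (t q : R) :
  (0 <= lam)%R -> (0 <= q)%R -> (0 <= t)%R -> poisson_process P lam N ->
  \int[P]_w (q ^+ N t w)%:E = (expR (- (lam * t * (1 - q))))%:E.
Proof.
move=> lam0 q0 t0 [N0 _ Nlaw].
rewrite (@ge0_integral_comp_nat _ _ _ P setT (N t) 
  (fun k => (q ^+ k)%:E))//; last first.
  by move=> k; rewrite lee_fin exprn_ge0.
rewrite -(@poisson_prob_pgf _ _ _ 0%N) ?mulr_ge0//.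
(* Since [N 0 = 0] almost surely, the law of [N t] is that of the increment from 0 to [t]. *)
apply: eq_eseriesr => k _; congr (_ * _); rewrite setTI -[in RHS](subr0 t) -Nlaw//.
apply: ae_iff_measure; first exact: measurable_nat_fiber.
  exact: measurable_nat_increment.
by apply: filterS N0 => w [/= -> _ _]; rewrite add0n.
Qed.

Lemma geometric_counting_process_pgf (mu : R) (G : R -> {RV P >-> nat})
    (t z : R) :
  (0 < mu)%R -> (0 <= z <= 1)%R -> (0 <= t)%R ->
  geometric_counting_process P mu G ->
  \sum_(n <oo) P (G t @^-1` [set n]) * (z ^+ n)%:E =
  (1 / (1 + mu * t * (1 - z)))%:E.
Proof.
move=> mu0 /andP[z0 z1] t0 [L [lawL [G0 mixG]]].
pose nu : probability R R := distribution P L.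
have mg n D : measurable D ->
    measurable_fun D (fun l : R => poisson_prob (l * t) 0%N [set n]).
  move=> mD.
  apply: (measurableT_comp (@measurable_poisson_prob1 setT 0%N n measurableT)).
  exact: mulrr_measurable.
have Glaw n : P (G t @^-1` [set n]) =
    \int[nu]_(l in `[0%R, +oo[) poisson_prob (l * t) 0%N [set n].
  (* The grid 0, t, t, ... with a single increment and [B = setT] extracts the one-dimensional law
     of [G t] from the disintegration. *)
  pose s (i : nat) : R := if i is 0%N then 0%R else t.
  have grid : time_grid s by split => //; case.
  transitivity (\int[nu]_l poisson_prob (l * t) 0%N [set n]).
    have := mixG 1%N s (fun=> n) setT grid measurableT.
    under eq_integral do rewrite big_ord1 /= subr0.
    move=> <-; apply: ae_iff_measure; first exact: measurable_nat_fiber.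
      apply: measurableI.
        by rewrite -[X in measurable X]setTI; exact: measurable_funP.
      apply: bigcap_measurable => [|i _]; first by exists 0%N.
      exact: measurable_nat_increment.
    apply: filterS G0 => w [/= G0 _ _].
    split => [/= Gt|[_ /(_ 0%N erefl)]] /=; last by rewrite G0.
    by split => // i; rewrite /= ltnS leqn0 => /eqP ->; rewrite /= G0.
  (* Negative rates are [nu]-null, since the exponential density vanishes there; discarding them
     makes [l * t] a legitimate Poisson parameter. *)
  rewrite (@ge0_negligible_integral _ _ _ nu setT `]-oo, 0%R[)//.
  - congr (integral _ _ _); apply/seteqP; split => l /=.
      by move=> [_]; rewrite !in_itv /= andbT => /negP; rewrite -leNgt.
    by rewrite !in_itv /= andbT leNgt => /negP.
  - exact: mg.
  - rewrite [LHS]lawL// /exponential_prob integral0_eq// => l /=.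
    by rewrite in_itv /= => l0; rewrite lt0_exponential_pdf.
have p0 l n : 0 <= poisson_prob (l * t) 0%N [set n].
  rewrite /poisson_prob; case: ifPn => // _.
  by apply: esum_ge0 => i _; rewrite lee_fin poisson_pmf_ge0.
have zn0 n : 0 <= (z ^+ n)%:E by rewrite lee_fin exprn_ge0.
(* Tonelli: sum and integral are exchanged so that the Poisson generating function can be evaluated
   for each fixed rate. *)
transitivity (\int[nu]_(l in `[0%R, +oo[)
    \sum_(n <oo) (z ^+ n)%:E * poisson_prob (l * t) 0%N [set n]).
  rewrite integral_nneseries//; last 2 first.
  - by move=> n; apply: emeasurable_funM => //; exact: mg.
  - by move=> n l _; rewrite mule_ge0.
  apply: eq_eseriesr => n _.
  by rewrite Glaw muleC ge0_integralZl//; exact: mg.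
transitivity (\int[nu]_(l in `[0%R, +oo[) (expR (- (t * (1 - z) * l)))%:E).
  apply: eq_integral => l; rewrite inE /= in_itv /= andbT => l0.
  by rewrite poisson_prob_pgf// ?mulr_ge0// mulrAC [in RHS]mulrC mulrA mulrAC.
have c0 : (0 <= t * (1 - z))%R by rewrite mulr_ge0// subr_ge0.
rewrite (exponential_laplace (a := mu^-1))// ?invr_gt0//; congr EFin.
have c1 : (1 + mu * t * (1 - z) != 0)%R.
  by rewrite gt_eqF// ltr_wpDr// -mulrA mulr_ge0// ltW.
by field; rewrite c1 gt_eqF.
Qed.

End processes.

(** * Measurability of truncation and local behaviour of counting paths *)

Section counting_paths.
Context (R : realType).

Lemma measurable_truncn : measurable_fun [set: R] (Num.truncn : R -> nat).
Proof.
apply: measurable_fun_natP => -[|k].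
  rewrite (_ : _ @^-1` _ = `]-oo, 1%R[%classic); first exact: measurable_itv.
  apply/seteqP; split => x /=; rewrite in_itv /=.
    by move=> x0; rewrite -(truncn_le_nat x 0) x0.
  by rewrite -(truncn_le_nat x 0) leqn0 => /eqP.
rewrite (_ : _ @^-1` _ = `[k.+1%:R, k.+2%:R[%classic); first exact: measurable_itv.
apply/seteqP; split => x /=; rewrite in_itv /= -truncn_gt_nat -truncn_le_nat.
  by move=> ->; rewrite !leqnn.
by rewrite andbC => /anti_leq.
Qed.

(** Right-continuity brings nearby values within distance less than 1, and integers that close are
    equal. *)
Lemma counting_path_right_locally_constant (x : R -> nat) (t : R) :
  counting_path x -> 0 <= t ->
  exists2 e : R, 0 < e & forall u, t <= u < t + e -> x u = x t.
Proof.
move=> [_ _ [rc _]] t0.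
have /cvgrPdist_lt/(_ 1 ltr01) := rc _ t0.
move=> [e /= e0 He]; exists e => // u /andP[].
rewrite le_eqVlt => /predU1P[->//|tu ute].
have : `|(x t)%:R - (x u)%:R| < 1 :> R.
  by apply: He => //=; rewrite distrC ger0_norm ?subr_ge0 ?ltW//; lra.
rewrite distrC ltr_norml => /andP[].
move=> xtu xut; apply/eqP.
rewrite eqn_leq -[(x u <= x t)%N]ltnS -[(x t <= x u)%N]ltnS.
by rewrite -!(ltr_nat R) -!natr1; apply/andP; split; lra.
Qed.

End counting_paths.

(** * Generating function of a Poisson process at an independent random time *)

Section subordination.
Context (R : realType) (d : measure_display) (Omega : measurableType d).
Variable P : probability Omega R.
Local Open Scope ereal_scope.

Lemma cvg_expectation_bounded (F_ : nat -> Omega -> R) (F : Omega -> R) :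
  (forall m, measurable_fun setT (F_ m)) -> measurable_fun setT F ->
  {ae P, forall w, F_ m w @[m --> \oo] --> F w} ->
  {ae P, forall w m, (0 <= F_ m w <= 1)%R} ->
  \int[P]_w (F_ m w)%:E @[m --> \oo] --> \int[P]_w (F w)%:E.
Proof.
move=> mF_ mF F_F F01.
have [] := @dominated_convergence _ _ _ P _ measurableT
  (fun m w => (F_ m w)%:E) (fun w => (F w)%:E) (cst 1) => //.
- by move=> m; exact/measurable_EFinP.
- exact/measurable_EFinP.
- by apply: filterS F_F => w F_F _; apply: cvg_EFin => //; exact: nearW.
- exact: finite_measure_integrable_cst.
- by apply: filterS F01 => w F01 m _; have /andP[? ?] := F01 m;
    rewrite /= ger0_norm// lee_fin.
Qed.

Variables (lam q : R) (N : R -> {RV P >-> nat}) (D : {RV P >-> R}).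
Variable Z : {RV P >-> nat}.
Hypotheses (lam0 : (0 <= lam)%R) (q01 : (0 <= q <= 1)%R).
Hypothesis hN : poisson_process P lam N.
Hypothesis D0 : {ae P, forall w, (0 <= D w)%R}.
Hypothesis hND : forall t (A : set R) k, (0 <= t)%R -> measurable A ->
  P (D @^-1` A `&` N t @^-1` [set k]) = P (D @^-1` A) * P (N t @^-1` [set k]).
Hypothesis hZ : forall w, Z w = N (D w) w.

Lemma subordinated_poisson_pgf :
  \int[P]_w (q ^+ Z w)%:E = \int[P]_w (expR (- (lam * (1 - q) * D w)))%:E.
Proof.
have /andP[q0 q1] := q01.
(* [K m] is the index of the cell of mesh 1/(m+1) containing [D], and [tau m (K m w)] is the right
   endpoint of that cell: an approximation from above, as right-continuity of [N] demands. *)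
pose K m w : nat := Num.truncn (D w * m.+1%:R).
pose tau m k : R := (k.+1%:R / m.+1%:R)%R.
have mK m : measurable_fun setT (K m).
  apply: (measurableT_comp (@measurable_truncn R)).
  by apply: measurable_funM.
have tau0 m k : (0 <= tau m k)%R by rewrite divr_ge0.
pose Zm m w := N (tau m (K m w)) w.
have mZm m : measurable_fun setT (Zm m).
  apply: measurable_fun_natP => j.
  rewrite (_ : _ @^-1` _ =
    \bigcup_k (K m @^-1` [set k] `&` N (tau m k) @^-1` [set j])).
    apply: bigcup_measurable => k _; apply: measurableI; last first.
      exact: measurable_nat_fiber.
    by rewrite -[X in measurable X]setTI; exact: mK.
  by apply/seteqP; split => [w /= Nw|w [k _ [/= <-]]//]; exists (K m w).
(* For this discrete time, conditioning on the cell reduces to the Poisson formula at the fixed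
   times [tau m k]; the resulting series is then read back as an expectation. *)
have ZmE m : \int[P]_w (q ^+ Zm m w)%:E =
    \int[P]_w (expR (- (lam * (1 - q) * tau m (K m w))))%:E.
  rewrite (@ge0_expectation_mixture _ _ _ P (K m) (Zm m) (fun k => N (tau m k))
    (fun k => (q ^+ k)%:E))//.
  - rewrite (@ge0_integral_comp_nat _ _ _ P setT (K m)
      (fun k => (expR (- (lam * (1 - q) * tau m k)))%:E))//.
    apply: eq_eseriesr => k _; rewrite setTI muleC; congr (_ * _).
    by rewrite (poisson_process_pgf (lam := lam))// mulrAC.
  - by move=> k; rewrite lee_fin exprn_ge0.
  - move=> k j; have := @hND (tau m k)
      ((fun x : R => Num.truncn (x * m.+1%:R)%R) @^-1` [set k]) j (tau0 m k).
    apply; rewrite -[X in measurable X]setTI.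
    apply: (measurableT_comp (@measurable_truncn R)) => //.
    exact: mulrr_measurable.
have ctau w : (0 <= D w)%R ->
    forall m, (D w <= tau m (K m w) <= D w + m.+1%:R^-1)%R.
  move=> Dw m; rewrite /tau /K.
  have /andP[l1 l2] := @truncn_itv R (D w * m.+1%:R) (mulr_ge0 Dw (ler0n _ _)).
  have m0 : (0 < m.+1%:R :> R)%R by [].
  rewrite ler_pdivlMr// (ltW l2)/= ler_pdivrMr// mulrDl mulVf ?gt_eqF//.
  by rewrite -natr1 lerD2r.
have cvgtau w : (0 <= D w)%R -> tau m (K m w) @[m --> \oo] --> D w.
  move=> Dw; apply: (@squeeze_cvgr _ _ _ _ (cst (D w))
    (fun m => D w + m.+1%:R^-1)%R).
  - by apply: nearW => m; exact: ctau.
  - exact: cvg_cst.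
  - rewrite -[X in _ --> X]addr0; apply: cvgD; [exact: cvg_cst|exact: cvg_harmonic].
(* Along almost every path the sequence is eventually constant: once 1/(m+1) < e, [N] takes the same
   value at the approximation as at [D]. *)
have L1 : \int[P]_w (q ^+ Zm m w)%:E @[m --> \oo] --> \int[P]_w (q ^+ Z w)%:E.
  apply: cvg_expectation_bounded.
  - by move=> m; exact: (measurableT_comp (f := fun k => (q ^+ k)%R)).
  - exact: (measurableT_comp (f := fun k => (q ^+ k)%R)).
  - have [Npath _ _] := hN.
    apply: filterS2 D0 Npath => w Dw Nw.
    have [e e0 He] := counting_path_right_locally_constant Nw Dw.
    apply: cvg_near_cst; near=> m.
    rewrite hZ /Zm He//; have /andP[-> /le_lt_trans] /= := ctau w Dw m; apply.
    rewrite ltrD2l; near: m; exact: (near_infty_natSinv_lt (PosNum e0)).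
  - by apply: nearW => w m; rewrite exprn_ge0// exprn_ile1.
have L2 : \int[P]_w (q ^+ Zm m w)%:E @[m --> \oo] -->
    \int[P]_w (expR (- (lam * (1 - q) * D w)))%:E.
  under eq_fun do rewrite ZmE.
  apply: cvg_expectation_bounded.
  - move=> m.
    exact: (measurableT_comp
      (f := fun k => expR (- (lam * (1 - q) * tau m k)))).
  - apply: measurableT_comp => //; apply: measurable_funN; exact: measurable_funM.
  - apply: filterS D0 => w Dw.
    apply: (@cvg_comp _ _ _ _ expR); last exact: continuous_expR.
    by apply: cvgN; apply: cvgM; [exact: cvg_cst|exact: cvgtau].
  - apply: nearW => w m; rewrite expR_ge0 expR_le1 oppr_le0.
    by rewrite !mulr_ge0// subr_ge0.
by have := cvg_unique _ L1 L2; apply.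
Unshelve. all: by end_near. Qed.

End subordination.

(** * Pathwise description of the lifetime; failure rate of a hyperbolic reliability *)

Section lifetimes.
Context (R : realType).

(** A fatal shock of index [i < m t] occurs by time [t], since [x i] belongs to shock [i.+1].
    Conversely, if there is none, no shock occurs in the flat stretch after [t], so every fatal
    shock time is at least [t + e]; this gap keeps the inequality strict under the infimum. *)
Lemma extreme_shock_lifetime_gt (gam : R) (m : R -> nat) (x : nat -> R) (t : R) :
  0 <= t -> (forall s u, 0 <= s -> s <= u -> (m s <= m u)%N) ->
  (exists2 e, 0 < e & forall u, t <= u < t + e -> m u = m t) ->
  (t%:E < extreme_shock_lifetime gam m x)%E <->
  forall i, (i < m t)%N -> x i <= gam.
Proof.
move=> t0 mm [e e0 me]; split => [tS i imt|xgam].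
  rewrite leNgt; apply/negP => gx; move: tS; apply/negP; rewrite -leNgt.
  apply: (@le_trans _ _ (shock_time m i.+1)).
    by apply: ereal_inf_lbound; exists i.
  by apply: ereal_inf_lbound; exists t.
apply: (@lt_le_trans _ _ (t + e)%:E); first by rewrite lte_fin ltrDl.
apply: le_ereal_inf_tmp => _ [i /= gx <-].
have mi : (m t <= i)%N.
  by rewrite leqNgt; apply/negP => /xgam; rewrite leNgt gx.
apply: le_ereal_inf_tmp => _ [u [u0 imu] <-].
rewrite lee_fin leNgt; apply/negP => ute.
have : (m u <= m t)%N.
  by have [tu|/ltW ut] := leP t u; [rewrite me// tu|exact: mm].
by rewrite leqNgt (leq_ltn_trans mi).
Qed.

Context (d : measure_display) (Omega : measurableType d).
Variable P : probability Omega R.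

(** Minus the log-reliability is ln(1 + a u), which is differentiable on both sides even at [t = 0].
    Its difference quotient agrees with that of the reliability wherever [t + h] is nonnegative, so
    the limit restricts to these [h]. *)
Lemma is_failure_rate_hyperbolic (S : {RV P >-> \bar R}) (a t : R) :
  0 <= a -> 0 <= t ->
  (forall u, 0 <= u -> reliability P S u = 1 / (1 + a * u)) ->
  is_failure_rate P S t (a / (1 + a * t)).
Proof.
move=> a0 t0 rel.
have lnrel u : 0 <= u -> ln (reliability P S u) = - ln (1 + a * u).
  by move=> u0; rewrite rel// div1r lnV// posrE ltr_wpDr// mulr_ge0.
have at0 : 0 < 1 + a * t by rewrite ltr_wpDr// mulr_ge0.
pose F u := ln (1 + a * u).
have dF : is_derive t 1 F (a / (1 + a * t)).
  have dg : is_derive t 1 (fun u : R => 1 + a * u) a.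
    by apply: is_derive_eq; rewrite add0r mul1r /GRing.scale/= mulr1.
  rewrite mulrC; pose g (u : R) := 1 + a * u.
  exact: (@is_derive1_comp _ _ g t _ a
    (is_derive1_ln at0 : is_derive (g t) 1 _ _) dg).
rewrite -[X in is_failure_rate _ _ _ X](derive_val (is_derive := dF)).
have Fcvg : h^-1 *: (F (h *: 1 + t) - F t) @[h --> 0^'] --> 'D_1 F t.
  exact: (@ex_derive _ _ _ _ _ _ _ dF).
apply: cvg_trans (cvg_within_filter [set h : R | 0 <= t + h] Fcvg).
apply: near_eq_cvg; rewrite near_withinE; apply: nearW => h /= th.
rewrite !lnrel// /F [h *: 1]mulr1 (addrC h) /GRing.scale/= -mulrN.
by congr (_ * _); ring.
Qed.

End lifetimes.

(** * Independence of magnitudes and shock counts; survival probability *)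

Section shock_models.
Context (R : realType) (d : measure_display) (Omega : measurableType d).
Variable P : probability Omega R.

Lemma process_sigma_preimage (d' : measure_display) (E : measurableType d')
    (I : Type) (J : set I) (X : I -> Omega -> E) (i : I) (B : set E) :
  J i -> measurable B -> process_sigma J X (X i @^-1` B).
Proof.
move=> Ji mB; apply: sub_sigma_algebra; exists i => //; exists B => //.
by rewrite setTI.
Qed.

Lemma process_sigma_bigcap_preimage (d' : measure_display) (E : measurableType d')
    (X : nat -> Omega -> E) (A : set nat) (B : set E) :
  measurable B -> process_sigma setT X (\bigcap_(i in A) (X i @^-1` B)).
Proof.
move=> mB; rewrite -[X in process_sigma _ _ X]setCK setC_bigcap.
apply: sigma_algebraC; rewrite (bigcup_mkcond A).
refine (sigma_algebra_bigcup _) => i; case: ifPn => _; last exact: sigma_algebra0.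
rewrite preimage_setC.
exact (process_sigma_preimage (I : setT i) (measurableC mB)).
Qed.

Lemma iid_all_le (X : nat -> {RV P >-> R}) (gam q : R) (k : nat) :
  iid P (fun i => X i) -> P [set w | X 0%N w <= gam] = q%:E ->
  P (\bigcap_(i in [set` iota 0 k]) (X i @^-1` `]-oo, gam])) = (q ^+ k)%:E.
Proof.
move=> [indX idX] hq; rewrite (indX _ (fun=> `]-oo, gam]%classic)) ?iota_uniq//.
have XE i : P (X i @^-1` `]-oo, gam]) = q%:E.
  by rewrite idX// -hq; congr (P _); apply/seteqP; split => w /=; rewrite in_itv.
under eq_bigr do rewrite XE.
by rewrite prodEFin big_const_seq count_predT size_iota iter_mulr_1.
Qed.

(** The event is split by the value k of [M]: the first k magnitudes all stay below the threshold
    with probability q^k, independently of [M = k]. *)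
Lemma extreme_shock_survival (X : nat -> {RV P >-> R}) (M : {RV P >-> nat})
    (gam q : R) :
  iid P (fun i => X i) -> P [set w | X 0%N w <= gam] = q%:E ->
  (forall (A : set Omega) (k : nat), process_sigma setT (fun i => X i) A ->
    P (A `&` M @^-1` [set k]) = (P A * P (M @^-1` [set k]))%E) ->
  measurable [set w | forall i, (i < M w)%N -> X i w <= gam] /\
  P [set w | forall i, (i < M w)%N -> X i w <= gam] =
  (\int[P]_w (q ^+ M w)%:E)%E.
Proof.
move=> iidX hq indXM.
have q0 : 0 <= q by rewrite -lee_fin -hq measure_ge0.
(* The list [iota 0 k] matches the finite index sequences of [mutually_independent]. *)
pose C k := \bigcap_(i in [set` iota 0 k]) (X i @^-1` `]-oo, gam]).
have mC k : measurable (C k).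
  have -> : C k = \bigcap_i
        (if i \in [set` iota 0 k] then X i @^-1` `]-oo, gam] else setT).
    by rewrite /C bigcap_mkcond.
  apply: bigcapT_measurable => i; case: ifPn => // _.
  by rewrite -[X in measurable X]setTI; exact: measurable_funP.
have CE : [set w | forall i, (i < M w)%N -> X i w <= gam] =
    \bigcup_k (C k `&` M @^-1` [set k]).
  apply/seteqP; split => [w Mw|w [k _ [Cw /= Mk]] i /=].
    exists (M w) => //; split => // i /=.
    by rewrite mem_iota /= add0n in_itv /=; exact: Mw.
  by move=> iM; have := Cw i; rewrite /= mem_iota /= add0n -Mk in_itv /=; exact.
have mCM k : measurable (C k `&` M @^-1` [set k]).
  by apply: measurableI => //; exact: measurable_nat_fiber.
split; first by rewrite CE; exact: bigcupT_measurable.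
rewrite CE measure_bigcup//; last first.
  by apply/trivIsetP => i j _ _ /eqP ij; apply/seteqP; split => // w
    [[_ /= Mi] [_ /= Mj]]; case: ij; rewrite -Mi.
rewrite (@ge0_integral_comp_nat _ _ _ P setT M 
  (fun k => (q ^+ k)%:E))//; last first.
  by move=> k; rewrite lee_fin exprn_ge0.
rewrite (eq_eseriesl (Q := xpredT)); last by move=> k; rewrite in_setT.
apply: eq_eseriesr => k _; rewrite setTI [LHS]indXM.
  by rewrite (iid_all_le k iidX hq).
exact: process_sigma_bigcap_preimage.
Qed.

End shock_models.

(** * Reliability and failure rate under the time-changed shock process *)

Theorem theorem3 (R : realType) (d : measure_display) (Omega : measurableType d)
  (P : probability Omega R)
  (b : R) (nu : {measure set R -> \bar R}) (lam mu gam q : R)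
  (D : R -> {RV P >-> R}) (N Nf G M : R -> {RV P >-> nat})
  (X : nat -> {RV P >-> R}) (S : {RV P >-> \bar R})
  (hb : 0 <= b)
  (hnu : levy_measure_pos nu)
  (hnu_infinite : nu `]0%R, +oo[%classic = +oo%E)
  (hD : levy_subordinator P D)
  (hD_laplace : forall s t : R, 0 <= s -> 0 <= t ->
     'E_P[fun w => expR (- (s * D t w))]%E
     = (expR (- (t * bernstein b nu s)))%:E)
  (hlam : 0 < lam)
  (hN : poisson_process P lam N)
  (hND : independent_processes P `[0, +oo[%classic `[0, +oo[%classic
           (fun t : R => N t) (fun t : R => D t))
  (hNf : forall (t : R) (w : Omega), 0 <= t -> Nf t w = N (D t w) w)
  (hmu : 0 < mu)
  (hG : geometric_counting_process P mu G)
  (hGNf : independent_processes P `[0, +oo[%classic `[0, +oo[%classic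
            (fun t : R => G t) (fun t : R => Nf t))
  (hM : forall (t : R) (w : Omega), 0 <= t -> M t w = Nf (G t w)%:R w)
  (hX : iid P (fun i => X i))
  (hXM : independent_processes P setT `[0, +oo[%classic
           (fun i => X i) (fun t : R => M t))
  (hq : P [set w | X 0%N w <= gam] = q%:E)
  (hS : forall w,
     S w = extreme_shock_lifetime gam (fun t : R => M t w) (fun i => X i w)) :
  forall t : R, 0 <= t ->
    P [set w | (t%:E < S w)%E]
    = (1 / (1 + mu * t * (1 - expR (- bernstein b nu (lam * (1 - q))))))%:E /\
    is_failure_rate P S t
      (mu * (1 - expR (- bernstein b nu (lam * (1 - q))))
       / (1 + mu * t * (1 - expR (- bernstein b nu (lam * (1 - q)))))).
Proof.
have q0 : 0 <= q by rewrite -lee_fin -hq measure_ge0.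
have q1 : q <= 1.
  rewrite -lee_fin -hq; apply: probability_le1.
  rewrite (_ : mkset _ = X 0%N @^-1` `]-oo, gam]).
    by rewrite -[X in measurable X]setTI; exact: measurable_funP.
  by apply/seteqP; split => w /=; rewrite in_itv.
set s := lam * (1 - q); set z := expR _.
have s0 : 0 <= s by rewrite mulr_ge0 ?subr_ge0// ltW.
have Dpath : {ae P, forall w,
    nondecreasing_path (fun t => D t w) /\ forall t, 0 <= t -> 0 <= D t w}.
  have [Dpath _ _] := hD; apply: filterS Dpath => w [D0 Dmono _].
  split => // t t0.
  by rewrite -D0; exact: Dmono.
(* At the integer time n the Laplace transform at [s] is exp(-n f(s)), which is the power
   [z ^+ n]. *)
have NfE n : (\int[P]_w (q ^+ Nf n%:R w)%:E = (z ^+ n)%:E)%E.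
  rewrite (@subordinated_poisson_pgf _ _ _ P lam q N (D n%:R) (Nf n%:R))//.
  - have := hD_laplace s n%:R s0 (ler0n _ _); rewrite unlock => ->.
    by rewrite /z -expRM_natl mulrN.
  - exact: ltW.
  - by rewrite q0.
  - by apply: filterS Dpath => w [_]; apply.
  - move=> u A k u0 mA; rewrite setIC muleC; apply: hND.
      by apply: process_sigma_preimage => //=; rewrite in_itv/= andbT.
    by apply: process_sigma_preimage => //=; rewrite in_itv/= andbT.
  - by move=> w; exact: hNf.
have z0 : 0 <= z by exact: expR_ge0.
(* Here [z] is read as the expectation of q^Nf(1), so the bound comes from [q <= 1]. *)
have z1 : z <= 1.
  rewrite -[z]expr1 -lee_fin -NfE.
  rewrite -(@probability_setT _ _ _ P) -[leRHS]mul1e -integral_cst//.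
  apply: ge0_le_integral => //.
  - by move=> w _; rewrite lee_fin exprn_ge0.
  - by apply/measurable_EFinP; exact: (measurableT_comp (f := fun k => q ^+ k)).
  - by move=> w _; rewrite lee_fin exprn_ile1.
have surv t : 0 <= t ->
    P [set w | (t%:E < S w)%E] = (1 / (1 + mu * t * (1 - z)))%:E.
  move=> t0.
  have indXM (A : set Omega) k : process_sigma setT (fun i => X i) A ->
      P (A `&` M t @^-1` [set k]) = (P A * P (M t @^-1` [set k]))%E.
    move=> hA; apply: hXM hA _.
    by apply: process_sigma_preimage => //=; rewrite in_itv/= andbT.
  have [mA PA] := extreme_shock_survival hX hq indXM.
  transitivity (P [set w | forall i, (i < M t w)%N -> X i w <= gam]).
    apply: ae_iff_measure => //.
      rewrite (_ : mkset _ = S @^-1` `]t%:E, +oo%E]%classic).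
        rewrite -[X in measurable X]setTI.
        by apply: measurable_funP => //; exact: emeasurable_itv.
      by apply/seteqP; split => w /=; rewrite in_itv /= ?leey ?andbT.
    (* Almost surely [M] is nondecreasing as a composition of nondecreasing paths. *)
    have [L [_ [Gpath _]]] := hG; have [Npath _ _] := hN.
    apply: filterS3 Dpath Gpath Npath => w [Dmono Dge0] Gw Nw; rewrite /= hS.
    apply: extreme_shock_lifetime_gt => //.
      move=> u v u0 uv; have v0 := le_trans u0 uv.
      rewrite !hM// !hNf// -(ler_nat R).
      have [_ Nmono _] := Nw; have [_ Gmono _] := Gw.
      by apply: Nmono; [exact: Dge0|apply: Dmono => //; exact: Gmono].
    (* [M u] depends on [u] only through [G u], so it is constant wherever [G] is. *)
    have [e e0 He] := counting_path_right_locally_constant Gw t0.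
    exists e => // u tu; have /andP[/(le_trans t0) u0 _] := tu.
    by rewrite !hM// He.
  rewrite PA -(geometric_counting_process_pgf hmu _ t0 hG)//; last by rewrite z0.
  rewrite (@ge0_expectation_mixture _ _ _ P (G t) (M t) (fun n => Nf n%:R)
    (fun k => (q ^+ k)%:E))//.
  - by apply: eq_eseriesr => n _; rewrite NfE.
  - by move=> k; rewrite lee_fin exprn_ge0.
  - by move=> w; exact: hM.
  - move=> k j; apply: hGNf.
      by apply: process_sigma_preimage => //=; rewrite in_itv/= andbT.
    by apply: process_sigma_preimage => //=; rewrite in_itv/= andbT.
move=> t t0; split; first exact: surv.
(* The hyperbolic parameter is a = mu (1 - z). *)
rewrite [mu * t * _]mulrAC; apply: is_failure_rate_hyperbolic => //.
  by rewrite mulr_ge0 ?subr_ge0// ltW.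
by move=> u u0; rewrite /reliability surv//= mulrAC.
Qed.
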